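(* Let $G$ be a connected graph of order $n$ and size $m$ with maximum degree $\Delta$ and minimum degree $\delta$. Then $$BSO(G)\geq \frac{\sqrt{2}}{\Delta^3+\delta^3}\left(\frac{m\delta^3}{\Delta}+\frac{F(G)}{2}\right),$$ with equality if and only if $G$ is a regular graph.
   Context: Graphs are finite, simple and undirected; order and size are the numbers of vertices and edges. For a connected graph $G$ with edge set $E(G)$, $d_v$ denotes the degree of the vertex $v$ in $G$. The first Banhatti-Sombor index is $BSO(G)=\sum_{uv\in E(G)}\sqrt{\frac{1}{d_u^2}+\frac{1}{d_v^2}}$ and the forgotten topological index is $F(G)=\sum_{uv\in E(G)}\left(d_u^2+d_v^2\right)$. *)

(* Defs.v *)
From mathcomp Require Import all_boot all_order all_algebra.

Set Implicit Arguments.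
Unset Strict Implicit.
Unset Printing Implicit Defensive.

Import Order.TTheory GRing.Theory Num.Theory.

Record sgraph := SGraph {
  vertex :> finType;
  adj : rel vertex;
  adj_sym : symmetric adj;
  adj_irr : irreflexive adj
}.

Section Graph.
Variable G : sgraph.
Implicit Types (u v : G) (A : {set G}).

(* An edge uv is the two-element set [set u; v]. *)
Definition edges : {set {set G}} :=
  [set A | [exists u, exists v, adj u v && (A == [set u; v])]].

Definition deg v : nat := #|[set u | adj v u]|.

Definition max_degree : nat := \max_(v : G) deg v.

(* The default #|G| exceeds every degree, so it is never attained as soon as
   G has a vertex. *)
Definition min_degree : nat := \big[minn/#|G|]_(v : G) deg v.

Definition connected : Prop := (0 < #|G|) /\ forall u v, connect (@adj G) u v.

Definition regular : Prop := exists k, forall v, deg v = k.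

(* In both indices, for the edge A = [set u; v] the inner sum over w \in A is
   the sum of the term at u and the term at v; see sum_edge. *)
Definition BSO (R : rcfType) : R :=
  (\sum_(A in edges) Num.sqrt (\sum_(w in A) 1 / (deg w)%:R ^+ 2))%R.

Definition forgotten : nat := \sum_(A in edges) \sum_(w in A) deg w ^ 2.

Lemma edgesP u v : ([set u; v] \in edges) = adj u v.
Proof.
rewrite inE; apply/existsP/idP => [[x /existsP[y /andP[xy /eqP E]]]|uv]; last first.
  by exists u; apply/existsP; exists v; rewrite uv eqxx.
have xDy : x != y by apply: contraTneq xy => ->; rewrite adj_irr.
have := set21 x y; have := set22 x y; rewrite -E !inE.
have := set21 u v; have := set22 u v; rewrite E !inE.
by do 4![case/orP => /eqP ?]; subst; rewrite ?eqxx // 1?adj_sym // in xDy xy *.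
Qed.

Lemma sum_edge (V : nmodType) (f : G -> V) u v :
  adj u v -> (\sum_(w in [set u; v]) f w = f u + f v)%R.
Proof.
move=> uv; rewrite big_setU1 ?big_set1 //= inE.
by apply: contraTneq uv => ->; rewrite adj_irr.
Qed.

Lemma min_degreeP : 0 < #|G| ->
  (exists v, deg v = min_degree) /\ forall v, min_degree <= deg v.
Proof.
move=> /card_gt0P[v0 _].
have le_min v : min_degree <= deg v.
  rewrite /min_degree; have : v \in index_enum G by rewrite mem_index_enum.
  elim: (index_enum G) => // x s IHs; rewrite inE big_cons geq_min.
  by case/predU1P => [<-|/IHs ->]; rewrite ?leqnn ?orbT.
split=> //; have : min_degree = #|G| \/ exists v, deg v = min_degree.
  rewrite /min_degree; elim/big_ind: _ => [|x y Hx Hy|v _]; first by left.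
    by rewrite /minn; case: ifP.
  by right; exists v.
by case=> // E; exists v0; apply/eqP; rewrite eqn_leq le_min andbT E max_card.
Qed.

End Graph.

(* Main.v *)
Require Import Defs.
From mathcomp Require Import all_boot all_order all_algebra.
From mathcomp Require Import ring lra.

(** Let x be the quadratic mean of the degrees s and t of the ends of an edge.
    The AM-GM inequality s t <= x^2 turns the contribution
    sqrt (1/s^2 + 1/t^2) = sqrt 2 * x / (s t) of that edge to BSO into at least
    sqrt 2 / x, with equality only for s = t.  On the other hand
    x * (delta^3 / Delta + x^2) increases with x and takes the value
    Delta^3 + delta^3 at x = Delta, whence
    sqrt 2 / x >= sqrt 2 / (Delta^3 + delta^3) * (delta^3 / Delta + x^2),
    with equality only for x = Delta.  Chaining the two gives [edge_leif], and
    summing over the edges gives the bound, because the terms x^2 add up to half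
    the forgotten index.

    Equality in the sum forces equality at each edge, that is, both ends of each
    edge have degree Delta.  The degree is then constant along edges, hence
    constant, since the graph is connected.  Conversely all the degrees of a
    regular graph are equal to Delta, which is the equality case at each edge. *)

Set Implicit Arguments.
Unset Strict Implicit.
Unset Printing Implicit Defensive.

Import Order.TTheory GRing.Theory Num.Theory.
Local Open Scope ring_scope.

(** Both comparisons of the edge estimate are read off a factored difference, of
    which one factor is positive and the other one carries the equality case. *)
Lemma leif_factor (R : realDomainType) (a b p q : R) :
  b - a = p * q -> 0 <= p -> 0 < q -> a <= b ?= iff (p == 0).
Proof.
move=> E p_ge0 q_gt0; split; first by rewrite -subr_ge0 E mulr_ge0 // ltW.
by rewrite eq_sym -subr_eq0 E mulf_eq0 (gt_eqF q_gt0) orbF.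
Qed.

(** Since 1/s^2 + 1/t^2 = 2 x^2 / (s t)^2, this is AM-GM in the form
    s t <= x^2, the defect of which is x^2 - s t = (s - t)^2 / 2. *)
Lemma quad_mean_leif (R : rcfType) (s t x : R) :
    0 < s -> 0 < t -> 0 < x -> x ^+ 2 = (s ^+ 2 + t ^+ 2) / 2 ->
  Num.sqrt 2 / x <= Num.sqrt (1 / s ^+ 2 + 1 / t ^+ 2) ?= iff (s == t).
Proof.
move=> s_gt0 t_gt0 x_gt0 Ex.
have [s0 t0 x0] : [/\ s != 0, t != 0 & x != 0] by rewrite !gt_eqF.
have -> : 1 / s ^+ 2 + 1 / t ^+ 2 = 2 * (x / (s * t)) ^+ 2.
  by rewrite expr_div_n Ex; field; rewrite s0 t0.
rewrite sqrtrM // sqrtr_sqr ger0_norm; last by rewrite divr_ge0 ?mulr_ge0 ?ltW.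
rewrite -[s == t]subr_eq0 -sqrf_eq0.
apply: (@leif_factor _ _ _ _ (Num.sqrt 2 / (2 * (s * t * x)))).
- have -> : (s - t) ^+ 2 = 2 * (x ^+ 2 - s * t) by rewrite Ex; field.
  by field; rewrite s0 t0 x0.
- exact: sqr_ge0.
- by rewrite divr_gt0 ?sqrtr_gt0 ?mulr_gt0.
Qed.

(** The factor D - x splits off because x * (d^3 / D + x^2) equals D^3 + d^3 at
    x = D. *)
Lemma inv_quad_mean_leif (R : rcfType) (D d x : R) :
    0 < x -> x <= D -> 0 <= d ->
  Num.sqrt 2 / (D ^+ 3 + d ^+ 3) * (d ^+ 3 / D + x ^+ 2) <= Num.sqrt 2 / x
    ?= iff (x == D).
Proof.
move=> x_gt0 xD d_ge0; have D_gt0 := lt_le_trans x_gt0 xD.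
have d3_ge0 : 0 <= d ^+ 3 by rewrite exprn_ge0.
have S_gt0 : 0 < D ^+ 3 + d ^+ 3 by rewrite ltr_pwDl // exprn_gt0.
rewrite eq_sym -[D == x]subr_eq0.
apply: (@leif_factor _ _ _ _
  (Num.sqrt 2 * (d ^+ 3 / D + (D ^+ 2 + D * x + x ^+ 2))
     / (x * (D ^+ 3 + d ^+ 3)))).
- by field; rewrite !gt_eqF.
- by rewrite subr_ge0.
- rewrite divr_gt0 ?mulr_gt0 ?sqrtr_gt0 // ltr_wpDl ?divr_ge0 ?(ltW D_gt0) //.
  by rewrite !addr_gt0 ?exprn_gt0 ?mulr_gt0.
Qed.

Lemma edge_leif (R : rcfType) (D d s t : R) :
    0 < s -> s <= D -> 0 < t -> t <= D -> 0 <= d ->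
  Num.sqrt 2 / (D ^+ 3 + d ^+ 3) * (d ^+ 3 / D + (s ^+ 2 + t ^+ 2) / 2)
    <= Num.sqrt (1 / s ^+ 2 + 1 / t ^+ 2) ?= iff (s == D) && (t == D).
Proof.
move=> s_gt0 sD t_gt0 tD d_ge0; set x := Num.sqrt ((s ^+ 2 + t ^+ 2) / 2).
have m_gt0 : 0 < (s ^+ 2 + t ^+ 2) / 2.
  by rewrite divr_gt0 ?addr_gt0 ?exprn_gt0.
have x_gt0 : 0 < x by rewrite sqrtr_gt0.
have Ex : x ^+ 2 = (s ^+ 2 + t ^+ 2) / 2 by rewrite sqr_sqrtr ?ltW.
have D_ge0 : 0 <= D by rewrite (le_trans _ sD) ?ltW.
have xD : x <= D.
  have s2 : s ^+ 2 <= D ^+ 2 by rewrite lerXn2r // nnegrE ltW.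
  have t2 : t ^+ 2 <= D ^+ 2 by rewrite lerXn2r // nnegrE ltW.
  by rewrite -(@ler_pXn2r _ 2) ?nnegrE ?(ltW x_gt0) // Ex; lra.
have -> : (s == D) && (t == D) = (x == D) && (s == t).
  apply/andP/andP => [[/eqP Es /eqP Et]|[/eqP xE /eqP st]].
    rewrite Es Et eqxx -(@eqrXn2 _ 2) ?(ltW x_gt0) // Ex Es Et.
    by split=> //; apply/eqP; field.
  suff Et : t = D by rewrite st Et eqxx.
  apply/eqP; rewrite -(@eqrXn2 _ 2) ?(ltW t_gt0) //.
  by rewrite -xE Ex st; apply/eqP; field.
rewrite -Ex; apply: leif_trans (inv_quad_mean_leif x_gt0 xD d_ge0) _.
exact: quad_mean_leif.
Qed.

Lemma edgeE (G : sgraph) (A : {set G}) :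
  A \in edges G -> exists u v, adj u v /\ A = [set u; v].
Proof.
by rewrite inE => /existsP[u /existsP[v /andP[uv /eqP ->]]]; exists u, v.
Qed.

Lemma deg_le_max (G : sgraph) (v : G) : (deg v <= max_degree G)%N.
Proof. exact: leq_bigmax. Qed.

Lemma deg_gt0 (G : sgraph) (u v : G) : adj u v -> (0 < deg u)%N.
Proof. by move=> uv; apply/card_gt0P; exists v; rewrite inE. Qed.

Lemma regular_deg (G : sgraph) (v : G) : regular G -> deg v = max_degree G.
Proof.
case=> k deg_k; apply/eqP; rewrite eqn_leq deg_le_max deg_k /=.
by apply/bigmax_leqP => i _; rewrite deg_k.
Qed.

(** The degree is invariant under adjacency, so its level sets are unions of
    connected components. *)
Lemma regular_of_adj (G : sgraph) : connected G ->
  (forall u v : G, adj u v -> deg u = deg v) -> regular G.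
Proof.
move=> [/card_gt0P[v0 _] conn] deg_adj; exists (deg v0) => v.
have deg_closed : closed (@adj G) [pred w | deg w == deg v0].
  by move=> u w uw; rewrite !inE (deg_adj _ _ uw).
by have := closed_connect deg_closed (conn v0 v); rewrite !inE eqxx => /esym/eqP.
Qed.

(** The equality case is kept as a statement about all edges, since this is the
    form in which equality in a sum of inequalities delivers it. *)
Lemma BSO_leif (R : rcfType) (G : sgraph) (d : R) : 0 <= d ->
  let D : R := (max_degree G)%:R in
  Num.sqrt 2 / (D ^+ 3 + d ^+ 3)
    * ((#|edges G|)%:R * d ^+ 3 / D + (forgotten G)%:R / 2) <= BSO G R
    ?= iff [forall (A | A \in edges G),
              [forall (w | w \in A), deg w == max_degree G]].
Proof.
move=> d_ge0 D; set c := Num.sqrt 2 / _.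
have -> : c * ((#|edges G|)%:R * d ^+ 3 / D + (forgotten G)%:R / 2) =
    \sum_(A in edges G) c * (d ^+ 3 / D + (\sum_(w in A) (deg w)%:R ^+ 2) / 2).
  rewrite -mulr_sumr big_split /= sumr_const -mulr_suml -mulrA mulr_natl.
  rewrite /forgotten natr_sum; congr (c * (_ + _ / 2)).
  by apply: eq_bigr => A _; rewrite natr_sum; apply: eq_bigr => w _; rewrite natrX.
apply: leif_sum => A /edgeE[u [v [uv ->]]].
have vu : adj v u by rewrite adj_sym.
have -> : [forall (w | w \in [set u; v]), deg w == max_degree G] =
    ((deg u)%:R == D) && ((deg v)%:R == D).
  rewrite !eqr_nat; apply/forall_inP/andP => [H|[Hu Hv] w].
    by rewrite !H ?set21 ?set22.
  by rewrite !inE => /orP[] /eqP->.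
rewrite !(sum_edge _ uv); apply: edge_leif => //.
- by rewrite ltr0n (deg_gt0 uv).
- by rewrite ler_nat deg_le_max.
- by rewrite ltr0n (deg_gt0 vu).
- by rewrite ler_nat deg_le_max.
Qed.

Theorem theorem3p14 (R : rcfType) (G : sgraph) (n m Delta delta : nat)
    (hconn : connected G)
    (hn : #|G| = n) (hm : #|edges G| = m)
    (hDelta : max_degree G = Delta) (hdelta : min_degree G = delta) :
  let bound : R :=
    Num.sqrt 2 / (Delta%:R ^+ 3 + delta%:R ^+ 3)
      * (m%:R * delta%:R ^+ 3 / Delta%:R + (forgotten G)%:R / 2) in
  BSO G R >= bound /\ (BSO G R = bound <-> regular G).
Proof.
rewrite -hm -hDelta -hdelta => bound.
have [le_bound eq_bound] := BSO_leif G (ler0n R (min_degree G)).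
split=> //; split=> [E|reg].
  apply: regular_of_adj => // u v uv.
  move: eq_bound; rewrite E eqxx => /esym/forall_inP/(_ [set u; v]).
  rewrite edgesP => /(_ uv)/forall_inP deg_max.
  by rewrite (eqP (deg_max u (set21 _ _))) (eqP (deg_max v (set22 _ _))).
apply/esym/eqP; rewrite eq_bound; apply/forall_inP => A _.
by apply/forall_inP => w _; rewrite (regular_deg w reg).
Qed.
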